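(* Let $G$ be a finite graph, $R=\Bbbk[G]$, and let $I=I(G)\subseteq R$ be its edge ideal. Then the homomorphisms $\phi_{ab}^{\lambda}$, for all edges $ab$ of $G$ and all $\lambda\in\Lambda_{ab}$, together with the homomorphisms $\phi_{a,L}^{\lambda}$, for all vertices $a$ of $G$, all nonempty subsets $L\subseteq V(\overline{N}(a))$ and all $\lambda\in\Gamma_{a,L}$, form a generating set of the $R$-module $\operatorname{Hom}_R(I,R/I)$.
   Context: Conventions. $\Bbbk$ is a field. Graphs are finite, have no multiple edges and no isolated vertices; loops are allowed. $R=\Bbbk[G]$ is the polynomial ring whose indeterminates are the vertices of $G$. The edge ideal $I=I(G)$ is generated by the monomials $ab$ with $\{a,b\}\in E(G)$ (so $a^2\in I$ if there is a loop on $a$); an edge $\{a,b\}$ is also denoted $ab$, where $a=b$ is allowed. $N(x)=\{y:\{x,y\}\in E(G)\}$, so $x\in N(x)$ iff there is a loop on $x$. For a monomial $m$, $\sqrt m$ is the largest square-free monomial dividing $m$. For a family of sets of vertices $(S_g)_{g\in T}$ indexed by a finite set $T$, $\prod_{g\in T}S_g$ denotes the set of monomials $\prod_{g\in T}x_g$ with $x_g\in S_g$ for each $g$; it is $\{1\}$ if $T=\emptyset$, and it is empty if some $S_g$ is empty. Type I homomorphisms. For an edge $ab$ (possibly $a=b$), let $\Lambda=\Lambda^{ab}=(N(a)\setminus\{b\})\cup(N(b)\setminus\{a\})$. For $g\in\Lambda$ let $\Lambda_g=N(g)\setminus\{a,b\}$, and let $\Lambda_{ab}=\{\sqrt m : m\in\prod_{g\in\Lambda}\Lambda_g\}$.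 For $\lambda\in\Lambda_{ab}$, $\phi_{ab}^\lambda:I\to R/I$ is the $R$-linear map sending the generator $ab$ to the class of $\lambda$ and every other minimal generator of $I$ to $0$ (it is well defined). Type II homomorphisms. For a vertex $a$, $\overline N(a)$ is the simple graph on the vertex set $N(a)$ in which two distinct vertices are adjacent iff they are not adjacent in $G$. For a nonempty subset $L\subseteq V(\overline N(a))=N(a)$, $\Gamma=\Gamma(L)$ is the set of vertices of $\overline N(a)$ not in $L$ that are adjacent in $\overline N(a)$ to some vertex of $L$. For $g\in\Gamma$ let $\Gamma_g=N(g)\setminus\{a\}$, and let $\Gamma_{a,L}=\{\sqrt m: m\in\prod_{g\in\Gamma}\Gamma_g\}$. For $\lambda\in\Gamma_{a,L}$, $\phi_{a,L}^\lambda:I\to R/I$ is the $R$-linear map sending a minimal generator $e$ of $I$ to the class of $\lambda x$ if $e=ax$ with $x\in L$, and to $0$ otherwise (it is well defined). *)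

(* Defs.v *)
From HB Require Import structures.
From mathcomp Require Import all_boot all_order all_algebra.
From mathcomp Require Import boolp.
From mathcomp Require Import mpoly.

Set Implicit Arguments.
Unset Strict Implicit.
Unset Printing Implicit Defensive.

Import GRing.Theory.
Local Open Scope ring_scope.
Local Open Scope quotient_scope.

(* Loops are allowed, and a vertex whose only edge is a loop is not isolated. *)
Record graph (V : finType) := Graph {
  adj : rel V;
  adj_sym : ssrbool.symmetric adj;
  adj_nonisolated : forall v, exists w, adj v w
}.

Section IdealModule.
Variables (R : comNzRingType) (I : idealr R).

(* The ambient R-module is the regular one, hence R^o. *)
Record ideal_mod := IdealMod {
  ideal_val : R^o;
  ideal_valP : ideal_val \in (I : {pred R})
}.

HB.instance Definition _ := [isSub for ideal_val].
HB.instance Definition _ := [Choice of ideal_mod by <:].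

Fact ideal_submod_closed : submod_closed ((I : {pred R}) : {pred R^o}).
Proof.
by split=> [|a u v uI vI]; [exact: idealr0 | apply: rpredD => //; exact: idealMr].
Qed.

HB.instance Definition _ :=
  GRing.SubChoice_isSubLmodule.Build R R^o _ ideal_mod ideal_submod_closed.

Definition quot_scale (r : R) (x : {ideal_quot I}) : {ideal_quot I} :=
  \pi_{ideal_quot I} r * x.

Fact quot_scaleA r s x :
  quot_scale r (quot_scale s x) = quot_scale (r * s) x.
Proof. by rewrite /quot_scale rmorphM mulrA. Qed.

Fact quot_scale1 : left_id 1 quot_scale.
Proof. by move=> x; rewrite /quot_scale rmorph1 mul1r. Qed.

Fact quot_scaleDr : right_distributive quot_scale +%R.
Proof. by move=> r x y; rewrite /quot_scale mulrDr. Qed.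

Fact quot_scaleDl x : {morph quot_scale^~ x : r s / r + s}.
Proof. by move=> r s; rewrite /quot_scale rmorphD mulrDl. Qed.

HB.instance Definition _ := GRing.Zmodule_isLmodule.Build R {ideal_quot I}
  quot_scaleA quot_scale1 quot_scaleDr quot_scaleDl.

End IdealModule.

(* S generates the R-module Hom_R(M, N), whose operations are pointwise. *)
Definition generates_Hom (R : comNzRingType) (M N : lmodType R)
    (S : {linear M -> N} -> Prop) : Prop :=
  forall f : {linear M -> N},
  exists (n : nat) (c : 'I_n -> R) (g : 'I_n -> {linear M -> N}),
    (forall i, S (g i)) /\ (forall u : M, f u = \sum_(i < n) c i *: g i u).

Section Monomials.
Variable V : finType.

Definition vmon (v : V) : 'X_{1..#|V|} := U_(enum_rank v)%MM.

Definition msqrt n (m : 'X_{1..n}) : 'X_{1..n} := [multinom minn (m i) 1 | i < n].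

Definition square_free n (m : 'X_{1..n}) : Prop := forall i, (m i <= 1)%N.

Lemma msqrtP n (m : 'X_{1..n}) :
  [/\ square_free (msqrt m), (msqrt m <= m)%MM &
      forall l : 'X_{1..n}, square_free l -> (l <= m)%MM -> (l <= msqrt m)%MM].
Proof.
split=> [i | | l lsf /mnm_lepP lm].
- by rewrite mnmE geq_minr.
- by apply/mnm_lepP=> i; rewrite mnmE geq_minl.
- by apply/mnm_lepP=> i; rewrite mnmE leq_min lm lsf.
Qed.

(* The set of monomials \prod_(g in T) x_g with x_g in S g. *)
Definition in_prod_sets (T : {set V}) (S : V -> {set V})
    (m : 'X_{1..#|V|}) : Prop :=
  exists x : V -> V,
    (forall g, g \in T -> x g \in S g) /\ m = (\sum_(g in T) vmon (x g))%MM.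

End Monomials.

Section EdgeIdeal.
Variables (k : fieldType) (V : finType) (G : graph V).

Local Notation R := {mpoly k[#|V|]}.

Definition edge_mon (a b : V) : 'X_{1..#|V|} := (vmon a + vmon b)%MM.

Definition edge_ideal : {pred R} := fun p =>
  `[< exists c : V -> V -> R,
        p = \sum_a \sum_(b | adj G a b) c a b * 'X_[edge_mon a b] >].

Fact edge_ideal_idealr_closed : idealr_closed edge_ideal.
Proof.
split.
- apply/asboolP; exists (fun _ _ => 0).
  by rewrite big1 // => a _; rewrite big1 // => b _; rewrite mul0r.
- apply/asboolP=> -[c] /(congr1 (fun p : R => p@_0%MM)).
  rewrite mcoeff1 eqxx raddf_sum big1 => [/eqP|a _]; first by rewrite oner_eq0.
  rewrite raddf_sum big1 // => b _ /=.
  rewrite [_@_0%MM]rmorphM /= mcoeffX [_ == _](_ : _ = false) ?mulr0 //.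
  apply/negP=> /eqP /mnmP /(_ (enum_rank a)).
  by rewrite mnm0E mnmDE /vmon mnm1E eqxx.
- move=> r p q /asboolP[c ->] /asboolP[d ->].
  apply/asboolP; exists (fun a b => r * c a b + d a b).
  rewrite mulr_sumr -big_split; apply: eq_bigr => a _ /=.
  rewrite mulr_sumr -big_split; apply: eq_bigr => b _ /=.
  by rewrite mulrDl mulrA.
Qed.

HB.instance Definition _ := isIdealr.Build R edge_ideal edge_ideal_idealr_closed.

Definition edge_module : lmodType R := ideal_mod edge_ideal.
Definition edge_quot : lmodType R := {ideal_quot edge_ideal}.

Fact edge_mon_in (a b : V) : adj G a b -> ('X_[edge_mon a b] : R) \in edge_ideal.
Proof.
move=> ab; apply/asboolP; exists (fun c d => ((c == a) && (d == b))%:R).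
rewrite (bigD1 a) //= [X in _ + X]big1 ?addr0 => [|c /negPf ca]; last first.
  by rewrite big1 // => d _; rewrite ca mul0r.
rewrite (bigD1 b) //= !eqxx mul1r big1 ?addr0 // => d /andP[_ /negPf ->].
by rewrite andbF mul0r.
Qed.

(* All edge monomials have degree 2, so they are precisely the minimal
   monomial generators of the edge ideal. *)
Definition edge_gen (a b : V) (ab : adj G a b) : edge_module :=
  IdealMod (edge_mon_in ab).

Definition mon_class (m : 'X_{1..#|V|}) : edge_quot :=
  \pi_{ideal_quot edge_ideal} ('X_[m] : R).

Definition nbhd (x : V) : {set V} := [set y | adj G x y].

Definition Lambda (a b : V) : {set V} := (nbhd a :\ b) :|: (nbhd b :\ a).

Definition Lambda_at (a b g : V) : {set V} := nbhd g :\: [set a; b].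

Definition Lambda_mon (a b : V) (l : 'X_{1..#|V|}) : Prop :=
  exists m, in_prod_sets (Lambda a b) (Lambda_at a b) m /\ l = msqrt m.

(* f is phi_{ab}^l; the condition determines f, as the edge monomials generate
   the edge ideal. *)
Definition is_phi_edge (a b : V) (l : 'X_{1..#|V|})
    (f : {linear edge_module -> edge_quot}) : Prop :=
  forall c d (cd : adj G c d),
    f (edge_gen cd) = if edge_mon c d == edge_mon a b then mon_class l else 0.

(* Adjacency in the simple graph \overline{N}(a), on the vertex set nbhd a. *)
Definition conbhd_adj (a x y : V) : bool :=
  [&& x \in nbhd a, y \in nbhd a, x != y & ~~ adj G x y].

Definition Gamma (a : V) (L : {set V}) : {set V} :=
  [set g in nbhd a | (g \notin L) && [exists x in L, conbhd_adj a x g]].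

Definition Gamma_at (a g : V) : {set V} := nbhd g :\ a.

Definition Gamma_mon (a : V) (L : {set V}) (l : 'X_{1..#|V|}) : Prop :=
  exists m, in_prod_sets (Gamma a L) (Gamma_at a) m /\ l = msqrt m.

(* f is phi_{a,L}^l *)
Definition is_phi_vertex (a : V) (L : {set V}) (l : 'X_{1..#|V|})
    (f : {linear edge_module -> edge_quot}) : Prop :=
  forall c d (cd : adj G c d),
    (forall x, x \in L -> edge_mon c d = edge_mon a x ->
       f (edge_gen cd) = mon_class (l + vmon x)%MM) /\
    ((forall x, x \in L -> edge_mon c d <> edge_mon a x) ->
       f (edge_gen cd) = 0).

Definition phi_family (f : {linear edge_module -> edge_quot}) : Prop :=
  (exists a b l, [/\ adj G a b, Lambda_mon a b l & is_phi_edge a b l f]) \/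
  (exists (a : V) (L : {set V}) l,
     [/\ L != set0, L \subset nbhd a, Gamma_mon a L l & is_phi_vertex a L l f]).

End EdgeIdeal.

(* Main.v *)
Require Import Defs.
From HB Require Import structures.
From mathcomp Require Import all_boot all_order all_algebra.
From mathcomp Require Import boolp zify.
From mathcomp Require Import ssrcomplements mpoly.

(* Write [f : I -> R/I] through the coefficients of the values [f e] on the
   edges [e] at the monomials outside [I], and peel off these terms one by one.
   A term at [m] of [f (ab)] has multidegree [m - ab].  If [m] involves neither
   [a] nor [b], the syzygies of [ab] with the edges meeting it force [m g] into
   [I] for every [g] in Lambda, so [m] contains a neighbour of each such [g] and
   hence is a multiple of some [lambda].  Otherwise [m = m' x] for an edge [ax]
   with [m'] free of [a]; let [L] be the set of those neighbours [y] of [a] for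
   which [f (ay)] has the same nonzero coefficient at [m' y]. The syzygies of
   [ay] and [ag], for [g] in Gamma(L), force [m' g] into [I], so [m'] is again a
   multiple of some [lambda]. In both cases a scaled multiple of a generator
   cancels the term without creating a new one, so the process terminates. *)

Set Implicit Arguments.
Unset Strict Implicit.
Unset Printing Implicit Defensive.

Import GRing.Theory.
Local Open Scope ring_scope.
Local Open Scope quotient_scope.

(** * Additive maps on polynomials prescribed on monomials *)

Section MonomialExtension.
Variables (k : fieldType) (n : nat) (M : lmodType {mpoly k[n]}).
Variable F : 'X_{1..n} -> M.

Definition mon_extend (p : {mpoly k[n]}) : M :=
  \sum_(m <- msupp p) (p@_m)%:MP *: F m.

Lemma mon_extendE d p : (msize p <= d)%N ->
  mon_extend p = \sum_(m : 'X_{1..n < d}) (p@_m)%:MP *: F m.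
Proof.
move=> le_pd; rewrite /mon_extend (big_mksub 'X_{1..n < d}) //=; first last.
- by move=> m /msize_mdeg_lt /leq_trans; apply.
- by rewrite msupp_uniq.
- by rewrite big_rmcond //= => i /memN_msupp_eq0 ->; rewrite mpolyC0 scale0r.
Qed.

Fact mon_extend_is_zmod_morphism : zmod_morphism mon_extend.
Proof.
move=> p q; pose d := maxn (msize (p - q)) (maxn (msize p) (msize q)).
rewrite (@mon_extendE d (p - q)) ?leq_maxl //.
rewrite (@mon_extendE d p) ?(@mon_extendE d q) ?leq_max ?leqnn ?orbT //.
rewrite -sumrB; apply: eq_bigr => m _.
by rewrite mcoeffB mpolyCB scalerBl.
Qed.

HB.instance Definition _ :=
  GRing.isZmodMorphism.Build {mpoly k[n]} M mon_extend mon_extend_is_zmod_morphism.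

Lemma mon_extendZX c m : mon_extend (c *: 'X_[m]) = c%:MP *: F m.
Proof.
have [->|c0] := eqVneq c 0; first by rewrite scale0r raddf0 mpolyC0 scale0r.
by rewrite /mon_extend msuppMCX // big_seq1 mcoeffZ mcoeffX eqxx mulr1.
Qed.

Lemma mon_extendX m : mon_extend 'X_[m] = F m.
Proof. by rewrite -['X_[m]]scale1r mon_extendZX mpolyC1 scale1r. Qed.

(** The rule for [F] is required only at the monomials of [p]. Hence a map that is linear merely on
    a monomial ideal can come from an [F] defined at every monomial. *)
Lemma mon_extend_scale r p :
  {in msupp p, forall m l, F (l + m)%MM = ('X_[l] : {mpoly k[n]}) *: F m} ->
  mon_extend (r * p) = r *: mon_extend p.
Proof.
move=> FX; rewrite {1 2}[p]mpolyE [r]mpolyE mulr_suml scaler_suml !raddf_sum /=.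
apply: eq_bigr => l _; rewrite mulr_sumr scaler_sumr !raddf_sum /=.
rewrite !big_seq; apply: eq_bigr => m mp.
rewrite -scalerAl -scalerAr scalerA -mpolyXD !mon_extendZX FX //.
by rewrite !scalerA -!mul_mpolyC mpolyCM mulrAC.
Qed.

End MonomialExtension.

(** * Monomials of the edge ideal and linear maps out of it *)

Section EdgeIdealMonomials.
Variables (k : fieldType) (V : finType) (G : graph V).
Local Notation R := {mpoly k[#|V|]}.
Local Notation I := (@edge_ideal k V G).
Local Notation Q := (edge_quot k G).

Definition edge_divides (m : 'X_{1..#|V|}) : bool :=
  [exists a, exists b, adj G a b && (edge_mon a b <= m)%MM].

Lemma edge_dividesP m :
  reflect (exists a b, adj G a b /\ (edge_mon a b <= m)%MM) (edge_divides m).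
Proof.
apply: (iffP existsP) => [[a /existsP[b /andP[ab abm]]]|[a [b [ab abm]]]].
  by exists a, b.
by exists a; apply/existsP; exists b; rewrite ab.
Qed.

Lemma edge_divides_le m l : edge_divides m -> (m <= l)%MM -> edge_divides l.
Proof.
move=> /edge_dividesP[a [b [ab abm]]] ml.
by apply/edge_dividesP; exists a, b; split=> //; apply: lepm_trans ml.
Qed.

Lemma edge_ideal_msupp p : p \in I -> {in msupp p, forall m, edge_divides m}.
Proof.
move=> /asboolP[c ->] m /msupp_sum_le /flattenP[/= s /mapP[a _ ->]].
move=> /msupp_sum_le /flattenP[/= s' /mapP[b]].
rewrite mem_filter => /andP[ab _] -> /msuppM_le /allpairsP[[l l'] /= [_]].
rewrite msuppX inE => /eqP -> ->.
by apply/edge_dividesP; exists a, b; split=> //; apply: lem_addl.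
Qed.

Lemma edge_ideal_X m : edge_divides m -> ('X_[m] : R) \in I.
Proof.
move=> /edge_dividesP[a [b [ab abm]]].
by rewrite -(submK abm) mpolyXD idealMr // edge_mon_in.
Qed.

Lemma mon_class_eq0 m : edge_divides m -> mon_class k G m = 0.
Proof.
move=> em; rewrite /mon_class -[0](rmorph0 (\pi_{ideal_quot I})).
by apply/eqP; rewrite -Quotient.idealrBE subr0 edge_ideal_X.
Qed.

Lemma mon_classD m l : mon_class k G (m + l) = ('X_[m] : R) *: mon_class k G l.
Proof. by rewrite /mon_class mpolyXD rmorphM. Qed.

Lemma edge_gen_eq a b c d (ab : adj G a b) (cd : adj G c d) :
  edge_mon a b = edge_mon c d -> edge_gen k ab = edge_gen k cd.
Proof. by move=> e; apply: val_inj; rewrite /= e. Qed.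

Lemma edge_module_span (f : {linear edge_module k G -> Q}) :
  (forall a b (ab : adj G a b), f (edge_gen k ab) = 0) -> forall u, f u = 0.
Proof.
move=> f0 u; have /asboolP[c uE] := ideal_valP u.
(* [edge_gen] takes a proof of adjacency, so it is extended by 0 to all pairs to make the sum
   expressible. *)
pose g a b : edge_module k G :=
  if @idP (adj G a b) is ReflectT ab then edge_gen k ab else 0.
have -> : u = \sum_a \sum_(b | adj G a b) c a b *: g a b.
  pose v : {linear edge_module k G -> R^o} := \val.
  apply: val_inj; rewrite -[RHS]/(v _) raddf_sum /= uE.
  apply: eq_bigr => a _; rewrite -[RHS]/(v _) raddf_sum.
  apply: eq_bigr => b ab; rewrite -[RHS]/(v _) linearZ /=.
  by rewrite /g; case: {-}_ / idP.
rewrite linear_sum big1 // => a _; rewrite linear_sum big1 // => b ab.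
rewrite linearZ /= /g; case: {-}_ / idP => // ab'.
by rewrite f0 scaler0.
Qed.

(** Prescribing values at all monomials of the ideal, not only at its generators, replaces the check
    of the syzygies by one compatibility rule. *)
Lemma edge_module_extend (F : 'X_{1..#|V|} -> Q) :
  (forall m l, edge_divides m -> F (l + m)%MM = ('X_[l] : R) *: F m) ->
  exists f : {linear edge_module k G -> Q},
    forall a b (ab : adj G a b), f (edge_gen k ab) = F (edge_mon a b).
Proof.
move=> FX; pose f (u : edge_module k G) : Q := mon_extend F (ideal_val u).
have fZ : linear f.
  move=> r u v; rewrite /f /= raddfD /= mon_extend_scale // => m mu l.
  by apply: FX; apply: edge_ideal_msupp mu; apply: ideal_valP.
pose f' := GRing.isLinear.Build R (edge_module k G) Q _ f fZ.
pose fL : {linear edge_module k G -> Q} := HB.pack f f'.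
by exists fL => a b ab; rewrite /= /f mon_extendX.
Qed.

End EdgeIdealMonomials.

(** * Coefficients of classes modulo the edge ideal *)

Section ClassCoefficients.
Variables (k : fieldType) (V : finType) (G : graph V).
Local Notation R := {mpoly k[#|V|]}.
Local Notation I := (@edge_ideal k V G).
Local Notation Q := (edge_quot k G).

(* Only meaningful when [m] is not divisible by an edge: then it does not
   depend on the representative of the class [q]. *)
Definition class_coef (q : Q) (m : 'X_{1..#|V|}) : k :=
  (repr (q : {ideal_quot I}))@_m.

Section Coefficient.
Variable m : 'X_{1..#|V|}.
Hypothesis Em : ~~ edge_divides G m.

Lemma class_coef_pi p : class_coef (\pi_{ideal_quot I} p) m = p@_m.
Proof.
apply/eqP; rewrite -subr_eq0 -mcoeffB mcoeff_eq0; apply: contra Em.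
apply: (@edge_ideal_msupp k).
by rewrite Quotient.idealrBE reprK.
Qed.

Lemma class_coefB (q q' : Q) :
  class_coef (q - q') m = class_coef q m - class_coef q' m.
Proof.
elim/quotW: q => q; elim/quotW: q' => q'.
by rewrite -[X in class_coef X]rmorphB !class_coef_pi mcoeffB.
Qed.

Lemma class_coef0 : class_coef 0 m = 0.
Proof. by rewrite -(subrr (0 : Q)) class_coefB subrr. Qed.

Lemma class_coefZ c (q : Q) :
  class_coef (c%:MP_[#|V|] *: q) m = c * class_coef q m.
Proof.
elim/quotW: q => q.
by rewrite -[X in class_coef X]rmorphM !class_coef_pi mcoeffCM.
Qed.

Lemma class_coef_mon l : class_coef (mon_class k G l) m = (l == m)%:R.
Proof. by rewrite class_coef_pi mcoeffX. Qed.

End Coefficient.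

Lemma class_coefX m l (q : Q) : ~~ edge_divides G m ->
  class_coef (('X_[l] : R) *: q) m =
    if (l <= m)%MM then class_coef q (m - l)%MM else 0.
Proof.
move=> Em; elim/quotW: q => q.
rewrite -[X in class_coef X]rmorphM class_coef_pi // mulrC.
have [lm|Nlm] := boolP (l <= m)%MM; last first.
  apply/eqP; rewrite mcoeff_eq0; apply: contra Nlm => /msuppM_le /allpairsP.
  by case=> -[a b] /= [_]; rewrite msuppX inE => /eqP -> ->; apply: lem_addl.
rewrite class_coef_pi; first by rewrite -[in LHS](submK lm) addmC mcoeffMX.
by apply: contra Em => /edge_divides_le; apply; apply: lem_subr.
Qed.

Lemma class_coef_inj0 (q : Q) :
  (forall m, ~~ edge_divides G m -> class_coef q m = 0) -> q = 0.
Proof.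
move=> q0; rewrite -(reprK (q : {ideal_quot I})).
rewrite -[0](rmorph0 (\pi_{ideal_quot I})).
apply/eqP; rewrite -Quotient.idealrBE subr0 [repr _]mpolyE big_seq.
apply: rpred_sum => m mq; rewrite -mul_mpolyC idealMr // edge_ideal_X //.
by apply: contraLR mq => /q0 /eqP; rewrite mcoeff_eq0.
Qed.

End ClassCoefficients.

(** * Divisibility among edges, vertices and monomials *)

Section VertexMonomials.
Variables (V : finType) (G : graph V).
Implicit Types (a b c d g h v w : V) (m l : 'X_{1..#|V|}).

Lemma mnm_le_add n (m1 m2 l1 l2 : 'X_{1..n}) :
  (m1 <= l1)%MM -> (m2 <= l2)%MM -> (m1 + m2 <= l1 + l2)%MM.
Proof.
move=> /mnm_lepP le1 /mnm_lepP le2; apply/mnm_lepP => i.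
by rewrite !mnmDE leq_add.
Qed.

Lemma vmonE a b : vmon a (enum_rank b) = (a == b).
Proof. by rewrite mnm1E (inj_eq enum_rank_inj). Qed.

Lemma mnm_vertexP m l :
  reflect (forall v, (m (enum_rank v) <= l (enum_rank v))%N) (m <= l)%MM.
Proof.
by apply: (iffP mnm_lepP) => [+ v|ml i]; [exact | rewrite -(enum_valK i)].
Qed.

Lemma vmon_le a m : (vmon a <= m)%MM = (0 < m (enum_rank a))%N.
Proof.
apply/mnm_vertexP/idP => [/(_ a)|m_gt0 v]; first by rewrite vmonE eqxx.
by rewrite vmonE; case: eqP => // <-.
Qed.

Lemma edge_monE a b v : edge_mon a b (enum_rank v) = ((a == v) + (b == v))%N.
Proof. by rewrite mnmDE !vmonE. Qed.

Lemma edge_monC a b : edge_mon a b = edge_mon b a.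
Proof. by rewrite /edge_mon addmC. Qed.

Lemma edge_mon_le_eq a b c d :
  (edge_mon a b <= edge_mon c d)%MM -> edge_mon a b = edge_mon c d.
Proof.
move=> le; have /eqP := congr1 mdeg (submK le).
rewrite !mdegD !mdeg1 -[X in _ == X]add0n eqn_add2r mdeg_eq0 => /eqP e.
by rewrite -(submK le) e add0m.
Qed.

Lemma edge_mon_swap a b c :
  (vmon c + edge_mon a b = vmon b + edge_mon a c)%MM.
Proof. by rewrite addmA (addmC (vmon c)) addmC. Qed.

Lemma vmon_le_sub a b m : (edge_mon a b <= m)%MM -> (vmon b <= m - vmon a)%MM.
Proof.
move=> /mnm_vertexP/(_ b); rewrite edge_monE eqxx vmon_le mnmBE vmonE.
by rewrite addn1 subn_gt0.
Qed.

Lemma edge_mon_le_sub a b c m : b != c ->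
  (edge_mon a b <= m)%MM -> (edge_mon a c <= m)%MM ->
  (edge_mon b c <= m - vmon a)%MM.
Proof.
move=> /negPf bc /vmon_le_sub bm /vmon_le_sub cm; apply/mnm_vertexP => v.
rewrite edge_monE; case: (eqVneq b v) => [<-|_].
  by rewrite eq_sym bc addn0 -vmon_le.
by case: (eqVneq c v) => [<-|_]; rewrite -?vmon_le.
Qed.

(** An edge dividing [m g] but not [m] must use [g]; its other end, which is [g] itself for a loop,
    divides [m]. *)
Lemma edge_divides_addv m g : ~~ edge_divides G m ->
  edge_divides G (m + vmon g)%MM -> exists2 h, adj G g h & (vmon h <= m)%MM.
Proof.
move=> Nm /edge_dividesP[u [v [uv /mnm_vertexP le]]].
have [gu|gu] := eqVneq g u.
  exists v; rewrite ?gu // vmon_le.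
  by have := le v; rewrite edge_monE mnmDE vmonE gu eqxx; lia.
have [gv|gv] := eqVneq g v.
  exists u; rewrite ?gv 1?(adj_sym G) // vmon_le.
  by have := le u; rewrite edge_monE mnmDE vmonE gv eqxx; lia.
case/edge_dividesP: Nm; exists u, v; split=> //; apply/mnm_vertexP => w.
have := le w; rewrite edge_monE mnmDE vmonE.
case: (eqVneq g w) => [<-|_]; last by rewrite addn0.
by rewrite ![_ == g]eq_sym (negPf gu) (negPf gv).
Qed.

Lemma edge_divides_vmon m l g h : adj G g h ->
  (vmon g <= m)%MM -> (vmon h <= l)%MM -> edge_divides G (m + l)%MM.
Proof.
by move=> gh gm hl; apply/edge_dividesP; exists g, h; split=> //; apply: mnm_le_add.
Qed.

Lemma in_prod_sets_msqrt (T : {set V}) (S : V -> {set V}) m : in_prod_sets T S m ->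
  {in T, forall g, exists2 h, h \in S g & (vmon h <= msqrt m)%MM}.
Proof.
move=> [x [xS ->]] g gT; exists (x g); first exact: xS.
by rewrite vmon_le mnmE mnm_sumE (bigD1 g) //= vmonE eqxx.
Qed.

(** Choose for each [g] a vertex of [S g] dividing [m]. Choices may repeat, so their product need
    not divide [m], but its square-free part is their least common multiple and does. *)
Lemma in_prod_sets_exists (T : {set V}) (S : V -> {set V}) m :
  {in T, forall g, exists2 h, h \in S g & (vmon h <= m)%MM} ->
  exists l, in_prod_sets T S l /\ (msqrt l <= m)%MM.
Proof.
move=> hS; pose x g := odflt g [pick h in S g | (vmon h <= m)%MM].
have xP g : g \in T -> x g \in S g /\ (vmon (x g) <= m)%MM.
  move=> /hS[h hSg hm]; rewrite /x; case: pickP => [w /andP //|/(_ h)].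
  by rewrite hSg hm.
exists (\sum_(g in T) vmon (x g))%MM; split; first by exists x; split=> // g /xP[].
apply/mnm_lepP => i; rewrite mnmE mnm_sumE.
have [/eqP ->//|] := boolP (\sum_(g in T) vmon (x g) i == 0)%N.
rewrite sum_nat_eq0 negb_forall => /existsP[g]; rewrite negb_imply => /andP[gT].
rewrite -lt0n => xi; have [_ /mnm_lepP/(_ i)] := xP g gT.
by rewrite geq_min; case: (m i) xi => [|n]; rewrite ?orbT //; case: (vmon _ i).
Qed.

(* Two distinct edges: the quotient of a common multiple by one of them is
   still divisible by the other one, or by a vertex of [Lambda]. *)
Lemma edge_exchange a b c d m : adj G c d ->
  (edge_mon a b <= m)%MM -> (edge_mon c d <= m)%MM ->
  edge_mon c d != edge_mon a b ->
  edge_divides G (m - edge_mon a b)%MM \/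
  exists2 g, g \in Lambda G a b & (vmon g <= m - edge_mon a b)%MM.
Proof.
(* Two edges with a common end: the other end [d'] of the second one differs from [b'] and survives
   the division by the first edge. *)
have nbr a' b' c' d' : adj G c' d' -> c' = a' -> edge_mon c' d' != edge_mon a' b' ->
    (edge_mon a' b' <= m)%MM -> (edge_mon c' d' <= m)%MM ->
    exists2 g, g \in nbhd G a' :\ b' & (vmon g <= m - edge_mon a' b')%MM.
  move=> + e; rewrite {c'}e => a'd ne /mnm_vertexP abm /mnm_vertexP cdm.
  have db : d' != b' by apply: contra ne => /eqP ->.
  exists d'; first by rewrite !inE db.
  rewrite vmon_le mnmBE; move: (abm d') (cdm d'); rewrite !edge_monE eqxx.
  by rewrite [b' == _]eq_sym (negPf db); lia.
move=> cd abm cdm ne.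
have [ca|ca] := eqVneq c a.
  right; case: (nbr _ _ _ _ cd ca ne abm cdm) => g gN gm.
  by exists g => //; rewrite inE gN.
have [cb|cb] := eqVneq c b.
  right; rewrite (edge_monC a) in ne abm *; case: (nbr _ _ _ _ cd cb ne) => // g gN gm.
  by exists g => //; rewrite inE gN orbT.
have dc : adj G d c by rewrite (adj_sym G).
have [da|da] := eqVneq d a.
  right; rewrite (edge_monC c) in ne cdm.
  case: (nbr _ _ _ _ dc da ne) => // g gN gm.
  by exists g => //; rewrite inE gN.
have [db|db] := eqVneq d b.
  right; rewrite (edge_monC c) in ne cdm; rewrite (edge_monC a) in ne abm *.
  case: (nbr _ _ _ _ dc db ne) => // g gN gm.
  by exists g => //; rewrite inE gN orbT.
(* Without a common end, dividing by [ab] leaves the exponents of [c] and [d] intact. *)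
left; apply/edge_dividesP; exists c, d; split=> //; apply/mnm_vertexP => v.
move/mnm_vertexP/(_ v): cdm; move/mnm_vertexP/(_ v): abm.
rewrite mnmBE !edge_monE.
case: (eqVneq c v) => [<-|_]; first by rewrite ![_ == c]eq_sym (negPf ca) (negPf cb); lia.
case: (eqVneq d v) => [<-|_]; first by rewrite ![_ == d]eq_sym (negPf da) (negPf db); lia.
by [].
Qed.

End VertexMonomials.

(** * Existence of the homomorphisms of both types *)

Section Generators.
Variables (k : fieldType) (V : finType) (G : graph V).
Local Notation R := {mpoly k[#|V|]}.
Local Notation Q := (edge_quot k G).

(** Compatibility is in doubt only when [ab] divides [n m] but not [m]. Then [edge_exchange] leaves
    in [n m / ab] an edge or a vertex of [Lambda], and [l] contains a neighbour of the latter, so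
    the value at [n m] vanishes. *)
Lemma phi_edge_exists a b l :
  {in Lambda G a b, forall g, exists2 h, adj G g h & (vmon h <= l)%MM} ->
  exists f : {linear edge_module k G -> Q}, is_phi_edge a b l f.
Proof.
move=> hl; pose F m : Q :=
  if (edge_mon a b <= m)%MM then mon_class k G (m - edge_mon a b + l)%MM else 0.
have [|f fE] := @edge_module_extend k V G F; last first.
  exists f => c d cd; rewrite fE /F.
  have [->|ne] := eqVneq; first by rewrite lepm_refl -[X in (X - _)%MM]add0m addmK add0m.
  case: ifP => // /edge_mon_le_eq e; by rewrite e eqxx in ne.
move=> m n /edge_dividesP[c [d [cd cdm]]]; rewrite /F.
have mM : (m <= n + m)%MM by apply: lem_addl.
have [abm|abm] := boolP (edge_mon a b <= m)%MM.
  by rewrite (lepm_trans abm mM) -mon_classD addmA addmBA.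
rewrite scaler0; case: ifP => // abM; apply: mon_class_eq0.
have [||||eM|[g /hl[h gh hl' gM]]] := @edge_exchange V G a b c d (n + m) => //.
- exact: lepm_trans mM.
- by apply: contraNneq abm => <-.
- by apply: edge_divides_le eM _; apply: lem_addr.
- exact: edge_divides_vmon gM hl'.
Qed.

(** The critical case has an edge [cd] dividing [m], and an edge [ax] with [x] in [L] dividing
    [n m], while no such edge divides [m]. If [cd] avoids [a], it divides [n m / a]. If [c] is [a],
    then [d] is outside [L]: either [xd] is an edge dividing [n m / a], or [d] lies in [Gamma] and
    [l] contains a neighbour of [d]. *)
Lemma phi_vertex_exists a (L : {set V}) l : L \subset nbhd G a ->
  {in Gamma G a L, forall g, exists2 h, adj G g h & (vmon h <= l)%MM} ->
  exists f : {linear edge_module k G -> Q}, is_phi_vertex a L l f.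
Proof.
move=> LN hl; pose P (m : 'X_{1..#|V|}) := [exists x in L, (edge_mon a x <= m)%MM].
pose F m : Q := if P m then mon_class k G (m - vmon a + l)%MM else 0.
have [|f fE] := @edge_module_extend k V G F; last first.
  exists f => c d cd; rewrite fE /F; split=> [x xL e|ne].
    have -> : P (edge_mon c d).
      by apply/existsP; exists x; rewrite xL e lepm_refl.
    by rewrite e /edge_mon (addmC (vmon a)) addmK addmC.
  case: ifP => // /existsP[x /andP[xL /edge_mon_le_eq e]].
  by case: (ne x xL); rewrite e.
move=> m n /edge_dividesP[c [d [cd cdm]]]; rewrite /F.
have mM : (m <= n + m)%MM by apply: lem_addl.
have [Pm|Pm] := boolP (P m).
  have [x /andP[xL axm]] := existsP Pm.
  have -> : P (n + m)%MM by apply/existsP; exists x; rewrite xL (lepm_trans axm mM).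
  rewrite -mon_classD addmA addmBA //.
  by apply: lepm_trans axm; apply: lem_addr.
rewrite scaler0; case: ifP => // /existsP[x /andP[xL axM]]; apply: mon_class_eq0.
have cdM := lepm_trans cdm mM.
wlog ca : c d cd cdm cdM / (c == a) || ((c != a) && (d != a)).
  have dc : adj G d c by rewrite (adj_sym G).
  move=> W; have [ca|ca] := boolP (c == a); first by apply: (W c d) => //; rewrite ca.
  have [da|da] := boolP (d == a); last by apply: (W c d) => //; rewrite ca da orbT.
  by apply: (W d c) => //; rewrite 1?edge_monC // da.
move: (n + m)%MM axM cdM {mM} => M axM cdM.
case/orP: ca => [/eqP ca|/andP[ca da]]; last first.
  apply: (@edge_divides_le _ _ (M - vmon a)%MM); last exact: lem_addr.
  apply/edge_dividesP; exists c, d; split=> //; apply/mnm_vertexP => v.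
  move/mnm_vertexP/(_ v): cdM; rewrite mnmBE !edge_monE vmonE.
  case: (eqVneq a v) => [<-|_]; last by rewrite subn0.
  by rewrite (negPf ca) (negPf da).
rewrite {c}ca in cd cdm cdM *.
have dL : d \notin L.
  by apply: contra Pm => dL; apply/existsP; exists d; rewrite dL cdm.
have xd : x != d by apply: contraNneq dL => <-.
have dM := vmon_le_sub cdM.
have [xad|xad] := boolP (adj G x d).
  apply: (@edge_divides_le _ _ (M - vmon a)%MM); last exact: lem_addr.
  by apply/edge_dividesP; exists x, d; split=> //; apply: edge_mon_le_sub.
have [|h dh hl'] := hl d; last exact: edge_divides_vmon dM hl'.
rewrite !inE dL cd; apply/existsP; exists x; rewrite xL /conbhd_adj !inE.
by rewrite cd xd xad; have := subsetP LN x xL; rewrite inE => ->.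
Qed.

(** * Removing one term of a given homomorphism *)

Variable f : {linear edge_module k G -> Q}.

(** Both sides are the coefficient at [m] of [f] applied to one element of the ideal, written as a
    multiple of [ab] and as a multiple of [cd]. *)
Lemma class_coef_syzygy a b c d (ab : adj G a b) (cd : adj G c d) u v m :
  ~~ edge_divides G m -> (u + edge_mon a b = v + edge_mon c d)%MM ->
  (if (u <= m)%MM then class_coef (f (edge_gen k ab)) (m - u) else 0) =
  (if (v <= m)%MM then class_coef (f (edge_gen k cd)) (m - v) else 0).
Proof.
move=> Em e; rewrite -!class_coefX // -!linearZ; congr (class_coef (f _) m).
by apply: val_inj; rewrite /= /GRing.scale /= -!mpolyXD e.
Qed.

(* [c X^l g] removes from [f] the term at [m] of the value at [ab], and never
   creates a new term. *)
Definition peels a b (ab : adj G a b) m (g : {linear edge_module k G -> Q})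
    (l : 'X_{1..#|V|}) : Prop :=
  ('X_[l] : R) *: g (edge_gen k ab) = mon_class k G m /\
  forall c d (cd : adj G c d), ('X_[l] : R) *: g (edge_gen k cd) = 0 \/
    exists m', [/\ ~~ edge_divides G m',
      ('X_[l] : R) *: g (edge_gen k cd) = mon_class k G m' &
      class_coef (f (edge_gen k cd)) m' = class_coef (f (edge_gen k ab)) m].

Lemma peel_edge a b (ab : adj G a b) m : ~~ edge_divides G m ->
  class_coef (f (edge_gen k ab)) m != 0 ->
  ~~ (vmon a <= m)%MM -> ~~ (vmon b <= m)%MM ->
  exists g l, phi_family g /\ peels ab m g l.
Proof.
(* If [m g] were outside the ideal, the syzygy between [a'b'] and [a'g] at [m g] would kill the
   coefficient, because [b'] does not divide [m g]. *)
have nbr a' b' (ab' : adj G a' b') g : ~~ edge_divides G m ->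
    class_coef (f (edge_gen k ab')) m != 0 -> ~~ (vmon b' <= m)%MM ->
    g \in nbhd G a' :\ b' -> exists2 h, adj G g h & (vmon h <= m)%MM.
  move=> Em nz bm; rewrite !inE => /andP[gb ag].
  apply: edge_divides_addv => //; apply: contraR nz => Emg.
  have := @class_coef_syzygy _ _ _ _ ab' ag (vmon g) (vmon b') _ Emg.
  rewrite lem_addl addmK [X in _ -> _ = X]ifN.
    by move=> -> //; apply: edge_mon_swap.
  by move: bm; rewrite !vmon_le mnmDE vmonE (negPf gb) addn0.
move=> Em nz am bm.
have ba : adj G b a by rewrite (adj_sym G).
have hm : {in Lambda G a b, forall g, exists2 h, h \in Lambda_at G a b g & (vmon h <= m)%MM}.
  move=> g gL; have [h gh hm] : exists2 h, adj G g h & (vmon h <= m)%MM.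
    move: gL; rewrite inE => /orP[]; first exact: nbr nz bm.
    by apply: (@nbr b a ba); rewrite // (edge_gen_eq k ba ab) // edge_monC.
  exists h => //; rewrite !inE gh andbT; apply/norP.
  by split; apply: contraTneq hm => ->.
have [mu [muP muS]] := in_prod_sets_exists hm.
have [g gP] : exists g : {linear edge_module k G -> Q}, is_phi_edge a b (msqrt mu) g.
  apply: phi_edge_exists => g gL; have [h] := in_prod_sets_msqrt muP gL.
  by rewrite !inE => /andP[_ gh]; exists h.
exists g, (m - msqrt mu)%MM; split.
  by left; exists a, b, (msqrt mu); split=> //; exists mu.
split=> [|c d cd]; rewrite gP; first by rewrite eqxx -mon_classD submK.
have [e|_] := eqVneq; last by left; rewrite scaler0.
right; exists m; split=> //; first by rewrite -mon_classD submK.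
by rewrite (edge_gen_eq k cd ab).
Qed.

(* All the neighbours [y] of [a] at which [f] has the same coefficient in the
   given multidegree are treated at once, so that connected components of the
   complement graph play no role. *)
Lemma peel_vertex a x (ax : adj G a x) m : ~~ edge_divides G (m + vmon x)%MM ->
  class_coef (f (edge_gen k ax)) (m + vmon x) != 0 -> ~~ (vmon a <= m)%MM ->
  exists g l, phi_family g /\ peels ax (m + vmon x) g l.
Proof.
move=> Emx nz am; set c0 := class_coef _ _ in nz *.
pose L := [set y | `[< ~~ edge_divides G (m + vmon y)%MM /\ exists ay : adj G a y,
   class_coef (f (edge_gen k ay)) (m + vmon y) = c0 >]].
have Em : ~~ edge_divides G m.
  by apply: contra Emx => /edge_divides_le; apply; apply: lem_addr.
have LP y : y \in L -> ~~ edge_divides G (m + vmon y)%MM /\ exists ay : adj G a y,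
   class_coef (f (edge_gen k ay)) (m + vmon y) = c0 by rewrite inE => /asboolP.
have xL : x \in L by rewrite inE; apply/asboolP; split=> //; exists ax.
have LN : L \subset nbhd G a by apply/subsetP => y /LP[_ [ay _]]; rewrite inE.
have hm : {in Gamma G a L, forall g, exists2 h, h \in Gamma_at G a g & (vmon h <= m)%MM}.
  move=> g; rewrite !inE => /andP[ag /andP[gL /existsP[y /andP[yL]]]].
  rewrite /conbhd_adj !inE => /and4P[_ _ yg yNg].
  have [Emy [ay fy]] := LP y yL.
  (* Otherwise the syzygy between [ag] and [ay], read at [m y g], gives [ag] the coefficient [c0] at
     [m g], which puts [g] in [L]. *)
  have Emg : edge_divides G (m + vmon g)%MM.
    apply: contraR gL => Emg; apply/asboolP; split=> //; exists ag; rewrite -fy.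
    (* An edge dividing [m y g] but not [m y] joins [g] to a vertex of [m y]. That vertex is not
       [y], so it divides [m], and the edge would divide [m g]. *)
    have Emyg : ~~ edge_divides G (m + vmon y + vmon g)%MM.
      apply/negP => /(edge_divides_addv Emy)[h gh hmy].
      have hy : h != y by apply: contraNneq yNg => <-; rewrite (adj_sym G).
      move/negP: Emg; apply; rewrite addmC; apply: edge_divides_vmon gh (lepm_refl _) _.
      by move: hmy; rewrite !vmon_le mnmDE vmonE [y == h]eq_sym (negPf hy) addn0.
    have := @class_coef_syzygy _ _ _ _ ag ay (vmon y) (vmon g) _ Emyg.
    rewrite lem_addl addmK -(addmA m) (addmC (vmon y) (vmon g)) addmA.
    by rewrite lem_addl addmK; apply; apply: edge_mon_swap.
  have [h gh hm] := edge_divides_addv Em Emg; exists h => //.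
  by rewrite !inE gh andbT; apply: contraTneq hm => ->.
have [mu [muP muS]] := in_prod_sets_exists hm.
have [g gP] : exists g : {linear edge_module k G -> Q}, is_phi_vertex a L (msqrt mu) g.
  apply: phi_vertex_exists => // g gL; have [h] := in_prod_sets_msqrt muP gL.
  by rewrite !inE => /andP[_ gh]; exists h.
have gL y c d (cd : adj G c d) : y \in L -> edge_mon c d = edge_mon a y ->
    ('X_[m - msqrt mu] : R) *: g (edge_gen k cd) = mon_class k G (m + vmon y).
  by move=> yL e; have [/(_ y yL e) -> _] := gP c d cd; rewrite -mon_classD addmA submK.
exists g, (m - msqrt mu)%MM; split.
  right; exists a, L, (msqrt mu); split=> //; last by exists mu.
  by apply/set0Pn; exists x.
split=> [|c d cd]; first exact: gL.
have [[y yL e]|Ne] := pselect (exists2 y, y \in L & edge_mon c d = edge_mon a y).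
  have [Emy [ay fy]] := LP y yL.
  right; exists (m + vmon y)%MM; split=> //; first exact: gL.
  by rewrite (edge_gen_eq k cd ay).
have [_ ->] := gP c d cd; first by left; rewrite scaler0.
by move=> y yL e; apply: Ne; exists y.
Qed.

Lemma peel_exists a b (ab : adj G a b) m : ~~ edge_divides G m ->
  class_coef (f (edge_gen k ab)) m != 0 ->
  exists g l, phi_family g /\ peels ab m g l.
Proof.
move=> Em nz.
(* When the end [d] divides [m], the other end [c] serves as centre: [c] does not divide [m / d], or
   else the edge [cd] would divide [m]. *)
have center c d (cd : adj G c d) : edge_mon c d = edge_mon a b -> (vmon d <= m)%MM ->
    exists g l, phi_family g /\ peels ab m g l.
  move=> e dm; have ge := edge_gen_eq k cd ab e.
  have [|||g [l [gP [g1 g2]]]] := @peel_vertex c d cd (m - vmon d)%MM.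
  - by rewrite submK.
  - by rewrite submK // ge.
  - apply: contra Em => cm; apply/edge_dividesP; exists c, d; split=> //.
    by rewrite -(submK dm); apply: mnm_le_add cm (lepm_refl _).
  exists g, l; split=> //; rewrite submK // ge in g1 g2.
  by split=> // u v uv; have := g2 u v uv.
have [am|am] := boolP (vmon a <= m)%MM.
  by apply: (@center b a) => //; rewrite 1?(adj_sym G) // edge_monC.
have [bm|bm] := boolP (vmon b <= m)%MM; first exact: (@center a b).
exact: peel_edge.
Qed.

End Generators.

(** * Termination of the peeling process *)

Section Generation.
Variables (k : fieldType) (V : finType) (G : graph V).
Local Notation R := {mpoly k[#|V|]}.
Local Notation Q := (edge_quot k G).
Local Notation M := (edge_module k G).

(** An upper bound for the set of terms suffices, since only its length drives the induction.
    Indexing by the edge monomial identifies the two orientations of an edge. *)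
Definition coef_support_in (f : {linear M -> Q})
    (S : seq ('X_{1..#|V|} * 'X_{1..#|V|})) : Prop :=
  forall a b (ab : adj G a b) m, ~~ edge_divides G m ->
    class_coef (f (edge_gen k ab)) m != 0 -> (edge_mon a b, m) \in S.

Lemma coef_support_exists f : exists S, coef_support_in f S.
Proof.
have supp (p : V * V) : exists s : seq 'X_{1..#|V|},
    forall (ab : adj G p.1 p.2) m, class_coef (f (edge_gen k ab)) m != 0 -> m \in s.
  have [ab|Nab] := pselect (adj G p.1 p.2); last by exists [::] => ab.
  exists (msupp (repr (f (edge_gen k ab) : {ideal_quot @edge_ideal k V G}))).
  by move=> ab' m; rewrite (bool_irrelevance ab' ab) mcoeff_msupp.
have [s sP] := choice supp.
exists [seq (edge_mon p.1 p.2, m) | p <- enum {: V * V}, m <- s p].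
move=> a b ab m _ nz; apply/allpairsPdep; exists (a, b), m.
by rewrite mem_enum (sP (a, b) ab m nz).
Qed.

(** Induction on the length of [S]: subtracting the peeled multiple of a generator removes the entry
    of one term, and the remaining entries still cover the new map. *)
Lemma generates_of_coef_support f S : coef_support_in f S ->
  exists (n : nat) (c : 'I_n -> R) (g : 'I_n -> {linear M -> Q}),
    (forall i, phi_family (g i)) /\ (forall u, f u = \sum_(i < n) c i *: g i u).
Proof.
have [N] := ubnP (size S); elim: N => // N IH in f S *; rewrite ltnS => leSN suppf.
have [[a [b [ab [m [Em nz]]]]]|f0] := pselect (exists a b (ab : adj G a b) m,
    ~~ edge_divides G m /\ class_coef (f (edge_gen k ab)) m != 0); last first.
  exists 0%N, (fun=> 0), (fun=> f); split=> [[]//|u]; rewrite big_ord0.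
  apply: edge_module_span u => a b ab; apply: class_coef_inj0 => m Em.
  by apply/eqP; apply: contra_notT f0 => nz; exists a, b, ab, m.
have [g [l [gP [gab gcd]]]] := peel_exists Em nz.
set c0 := class_coef _ _ in nz gcd.
pose c1 : R := c0%:MP * 'X_[l].
pose f1 : {linear M -> Q} := f \- (c1 \*: g).
have f1E c d (cd : adj G c d) m' : ~~ edge_divides G m' ->
    class_coef (f1 (edge_gen k cd)) m' = class_coef (f (edge_gen k cd)) m' -
      c0 * class_coef (('X_[l] : R) *: g (edge_gen k cd)) m'.
  by move=> Em'; rewrite class_coefB //= -scalerA class_coefZ.
have [||n [c [h [hP f1h]]]] := IH f1 [seq p <- S | p != (edge_mon a b, m)].
- apply: leq_trans leSN; rewrite size_filter -(count_predC (pred1 (edge_mon a b, m)) S).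
  rewrite -[X in (X < _)%N]add0n ltn_add2r -has_count has_pred1.
  exact: suppf.
- move=> c d cd m' Em'; rewrite f1E // mem_filter => nz'; apply/andP; split.
    apply: contra nz' => /=; rewrite xpair_eqE => /andP[/eqP e /eqP ->].
    rewrite (edge_gen_eq k cd ab) // gab.
    by rewrite class_coef_mon // eqxx mulr1 subrr.
  (* No new term arises: where [f] has coefficient 0, a term of the subtracted map would force [c0]
     to be 0. *)
  apply: suppf => //; apply: contraNneq nz' => fm'.
  have [->|[m2 [Em2 -> fm2]]] := gcd c d cd.
    by rewrite fm' class_coef0 // mulr0 subr0.
  rewrite class_coef_mon // fm'; have [m2m'|_] := eqVneq m2 m'; last first.
    by rewrite mulr0 subr0.
  by rewrite -fm2 m2m' fm' mul0r subr0.
(* Index 0 carries the peeled generator, the others those of the induction hypothesis. *)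
exists n.+1, (fun i => oapp c c1 (unlift ord0 i)), (fun i => oapp h g (unlift ord0 i)).
split=> [i|u]; first by case: (unlift ord0 i) => [j|] //=; apply: hP.
rewrite big_ord_recl unlift_none /=.
under eq_bigr do rewrite liftK /=.
by rewrite -f1h /= addrC subrK.
Qed.

End Generation.

Theorem theorem2p7 (k : fieldType) (V : finType) (G : graph V) :
  generates_Hom (@phi_family k V G).
Proof.
move=> f; have [S fS] := coef_support_exists f.
exact: generates_of_coef_support fS.
Qed.
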